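(* Let $n,k$ be integers with $n\geq 2$ and $n-1\geq k\geq 1$. There is a bijection between $\mathcal{OS}_2((1,2,\dots,n),k)$ and the set $\mathcal{IT}_2(n+k-1,k)$ of admissible internally ordered $k$-partitions of $\{1,2,\dots,n+k-1\}$.
   Context: Let $a_1,a_2,\dots,a_n$ ($n\ge 2$) be a list of distinct numbers. A nested set of the list $a_1,\dots,a_n$ is a parenthesization of the list that includes the maximal couple of parentheses $(a_1,a_2,\dots,a_n)$ and in which every couple of parentheses contains at least two numbers; equivalently, it is a set $S$ of blocks of consecutive entries of the list, each block having at least two entries, such that the whole list belongs to $S$ and any two blocks in $S$ are either disjoint or one is contained in the other (distinct couples of parentheses enclose distinct blocks). $|S|$ denotes the number of couples of parentheses, and $\mathcal{S}_2((a_1,\dots,a_n),k)$ is the set of nested sets $S$ of the list $a_1,\dots,a_n$ with $|S|=k$. Define $$\mathcal{OS}_2((a_1,\dots,a_n),k)=\bigcup_{\sigma\in S_n}\mathcal{S}_2((a_{\sigma(1)},a_{\sigma(2)},\dots,a_{\sigma(n)}),k),$$ where $S_n$ is the symmetric group; its elements are parenthesized lists, so parenthesizations of different lists are different elements (the union is disjoint). An internally ordered $k$-partition ($k\ge1$) of a finite set $X$ is an unordered partition $\{P_1,\dots,P_k\}$ of $X$ into $k$ (nonempty) parts together with a total ordering of the elements of $P_i$ for each $1\le i\le k$ (arbitrary, not related to any given order on $X$). It is admissible if every part $P_i$ has cardinality at least $2$. *)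

(* Defs.v *)
From mathcomp Require Import all_boot all_fingroup.

Set Implicit Arguments.
Unset Strict Implicit.
Unset Printing Implicit Defensive.

Section NestedSets.
Variables (T : finType) (n : nat).
Implicit Types (a : n.-tuple T) (B : {set T}) (S : {set {set T}}).

(* The entries of a list are meant to be distinct, so a couple of parentheses
   is identified with the set of entries that it encloses. *)
Definition is_block a B : bool :=
  [exists i : 'I_n, exists j : 'I_n,
     B == [set tnth a p | p in 'I_n & i <= p <= j]].

Definition nested_set a S : bool :=
  [&& [set x in a] \in S,
      [forall B in S, is_block a B && (2 <= #|B|)]
    & [forall B in S, forall C in S,
         [|| [disjoint B & C], B \subset C | C \subset B]]].

(* A parenthesized list is a list paired with a nested set of it. Keeping the
   list makes the union in OS2 disjoint: the nested set alone does not
   determine the list. *)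
Definition S2 a (k : nat) : {set n.-tuple T * {set {set T}}} :=
  [set x | [&& x.1 == a, nested_set a x.2 & #|x.2| == k]].

Definition OS2 a (k : nat) : {set n.-tuple T * {set {set T}}} :=
  \bigcup_(sigma : 'S_n) S2 [tuple tnth a (sigma i) | i < n] k.

End NestedSets.

Section InternallyOrderedPartitions.
Variable T : finType.
Implicit Types (X B : {set T}) (R : {set T * T}).

Definition total_order_on B R : bool :=
  [&& R \subset setX B B,
      [forall x in B, (x, x) \in R],
      [forall x, forall y, ((x, y) \in R) && ((y, x) \in R) ==> (x == y)],
      [forall x, forall y, forall z,
         ((x, y) \in R) && ((y, z) \in R) ==> ((x, z) \in R)]
    & [forall x in B, forall y in B, ((x, y) \in R) || ((y, x) \in R)]].

Local Notation iopart U :=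
  ({set {set U}} * {ffun {set U} -> {set U * U}})%type.

(* The second component gives each part its total order; it is forced to be
   empty outside the parts, so that equality of pairs is equality of
   internally ordered partitions. *)
Definition internally_ordered_partition X (k : nat) (P : iopart T) : bool :=
  [&& partition P.1 X, #|P.1| == k
    & P.2 \in pfamily set0 P.1 (fun B => [pred R | total_order_on B R])].

Definition admissible (P : iopart T) : bool := [forall B in P.1, 2 <= #|B|].

End InternallyOrderedPartitions.

(* {1, ..., m} is represented by 'I_m = {0, ..., m - 1}; likewise the list
   (1, ..., m) is ord_tuple m. *)
Definition IT2 (m k : nat) :
    {set {set {set 'I_m}} * {ffun {set 'I_m} -> {set 'I_m * 'I_m}}} :=
  [set P | internally_ordered_partition [set: 'I_m] k P && admissible P].

(* Main.v *)
Require Import Defs.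
From mathcomp Require Import all_boot all_fingroup.
From mathcomp Require Import zify.

(* Both sets are finite, so it suffices to count them.

   Nested sets: let h(n, k, t) be the number of noncrossing families of k
   intervals of length at least 2 in a list of n points, with t maximal
   components (uncovered points included). If the last point is uncovered,
   delete it; otherwise delete the largest interval ending there, which leaves a
   family with more than t components, from which the deleted interval is
   recovered by t alone. The resulting recurrence is solved by
   n h(n, k, t) = t C(n + k - 1, k) c(n - t, k), where c(d, k) is the number of
   compositions of d into k parts. Nested sets are the case t = 1.

   Partitions: removing the part that contains a given element, together with its
   order, shows by induction on k that k! times the number of admissible
   internally ordered k-partitions of an m-set is m! c(m - k, k). For
   m = n + k - 1 this equals k! n! h(n, k, 1). *)

Set Implicit Arguments.
Unset Strict Implicit.
Unset Printing Implicit Defensive.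

(** * A recurrence and its solution *)

(* The number of compositions of d into k positive summands. *)
Definition ncomp (d k : nat) : nat :=
  match d, k with
  | 0, 0 => 1
  | d'.+1, k'.+1 => 'C(d', k')
  | _, _ => 0
  end.

(** Pascal's rule: [ncomp] in its first argument is the difference sequence of ['C(_, k)]. *)
Lemma sum_ncomp D k : \sum_(v < D.+1) ncomp v k = 'C(D, k).
Proof.
elim: D => [|D IH]; first by rewrite big_ord1; case: k.
by rewrite big_ord_recr /= IH; case: (k) => [|j]; rewrite ?bin0 // binS.
Qed.

Lemma sum_mul_ncomp D k s :
  \sum_(v < D.+1) (s + (D.+1 - v)) * ncomp v k = s * 'C(D, k) + 'C(D.+1, k.+1).
Proof.
under eq_bigr => v _ do rewrite mulnDl.
rewrite big_split /= -big_distrr /= sum_ncomp; congr (_ + _).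
elim: D => [|D IH]; first by rewrite big_ord1 subn0 mul1n; case: k => [|k].
(* Raising [D] by one adds one copy of [ncomp v k] to each term, so the weights amount to summing
   [sum_ncomp] once more. *)
rewrite (eq_bigr (fun v : 'I_D.+2 => ncomp v k + (D.+1 - v) * ncomp v k)); last first.
  by move=> v _; rewrite -mulSn subSn // -ltnS.
by rewrite big_split /= sum_ncomp big_ord_recr /= subnn mul0n addn0 IH addnC -binS.
Qed.

Section Recurrence.
Variables (N : nat) (h : nat -> nat -> nat -> nat).
Hypothesis h_k0 : forall n t, n <= N -> h n 0 t = (t == n).
Hypothesis h_n0 : forall k t, h 0 k.+1 t = 0.
Hypothesis h_t0 : forall n k, n < N -> h n.+1 k 0 = 0.
Hypothesis h_rec : forall n k t, n < N ->
  h n.+1 k.+1 t.+1 = h n k.+1 t + \sum_(t.+2 <= u < n.+2) h n.+1 k u.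

(** Induction on [n], then on [k]: [h_rec] refers to a shorter list or to fewer intervals. The
    factor [n] on the left avoids a division. *)
Lemma recurrence_solution n k t : n <= N -> t <= n ->
  n * h n k t = t * 'C((n + k).-1, k) * ncomp (n - t) k.
Proof.
elim: n k t => [|n IHn] k t ltnN; first by rewrite leqn0 => /eqP ->.
elim: k t => [|k IHk] t letn.
  rewrite h_k0 // bin0 muln1; case: eqVneq => [->|]; first by rewrite subnn.
  move=> netn; rewrite muln0; have [d ->] : {d | n.+1 - t = d.+1} by exists (n - t); lia.
  by rewrite muln0.
case: t letn => [|t] letn; first by rewrite h_t0 // muln0.
rewrite h_rec // subSS.
have [eqtn|neqtn] := eqVneq t n.
  (* As many components as points leave no room for an interval. The induction hypothesis carries a
     factor [n], so [n = 0] falls to [h_n0]. *)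
  have -> : h n k.+1 t = 0.
    have := IHn k.+1 t (ltnW ltnN) letn; rewrite eqtn subnn muln0.
    by case: n {IHn IHk letn ltnN eqtn} => [|n] /eqP; rewrite ?h_n0 // muln_eq0 => /eqP.
  rewrite {1}eqtn big_geq // eqtn subnn /= !muln0 //.
have [D def_n] : {D | n = (t + D).+1} by exists (n - t).-1; lia.
have n_gt0 : 0 < n by rewrite def_n.
have -> : n - t = D.+1 by lia.
(* The extra factor [n] is what the induction hypothesis for [h n k.+1 t] requires; the terms of the
   sum already have their factor [n.+1]. *)
apply/eqP; rewrite -(eqn_pmul2l n_gt0) mulnDr mulnDr; apply/eqP.
rewrite [n * (_ * h _ _ _)]mulnCA IHn ?(ltnW ltnN) //.
have -> : n - t = D.+1 by lia.
rewrite /= big_distrr /=.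
rewrite (eq_big_nat _ _ (F2 := fun u => 'C(n + k, k) * (u * ncomp (n.+1 - u) k))); last first.
  by move=> u /andP[_ ltun]; rewrite IHk 1?addSn //= mulnCA mulnA.
rewrite -big_distrr /= big_nat_rev /= -{1}(add0n t.+2) big_addn.
have -> : n.+2 - t.+2 = D.+1 by lia.
rewrite big_mkord.
(* The reversed sum runs over [v = n.+1 - u], and [n = (t + D).+1] turns the weight [u] into
   [t.+1 + (D.+1 - v)]. *)
rewrite (eq_bigr (fun v : 'I_D.+1 => (t.+1 + (D.+1 - v)) * ncomp v k)); last first.
  by move=> [v ltv] _ /=; congr (_ * ncomp _ _); lia.
rewrite sum_mul_ncomp addnS /=.
have := mul_bin_diag D.+1 k; have := mul_bin_left (n + k) k.
rewrite addnK (binS (n + k)) /=.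
set a := 'C(n + k, k.+1); set b := 'C(n + k, k).
set c := 'C(D, k); set d := 'C(D.+1, k.+1) => e1 e2.
(* After cancellation the goal is [t * a * c + n * b * d = n * a * c], which follows from this
   identity and [n = (t + D).+1]. *)
have e : a * (D.+1 * c) = n * b * d.
  by apply/eqP; rewrite -(eqn_pmul2l (ltn0Sn k)) e2 mulnA e1; apply/eqP; nia.
have -> : n.+1 * (t * a * c) = n * (t * a * c) + t * a * c by lia.
have -> : n * (b * (t.+1 * c + d)) = n * (b * (t.+1 * c)) + n * b * d by nia.
rewrite -e {2 3}def_n; nia.
Qed.
End Recurrence.

(** * Noncrossing families of intervals *)

(** Delete the largest element until [s.+1] are left; the maximum of the rest is [i]. This locates
    an interval's left end from a number of components. *)
Lemma threshold_exists N (X : {set 'I_N}) s : s < #|X| ->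
  exists2 i, i \in X & #|[set j in X | j <= i]| = s.+1.
Proof.
elim: {X}_.+1 {-2}X (ltnSn #|X|) => // m IH X; rewrite ltnS => leX ltsX.
have [x0 X0] : exists x, x \in X by apply/set0Pn; rewrite -card_gt0; lia.
have [i Xi maxi] : exists2 i : 'I_N, i \in X & forall j, j \in X -> j <= i.
  by case: (arg_maxnP (fun i : 'I_N => nat_of_ord i) X0) => i; exists i.
have [es|nes] := eqVneq s.+1 #|X|.
  exists i => //; rewrite es; apply: eq_card => j; rewrite !inE.
  by apply: andb_idr => /maxi.
have cX := cardsD1 i X; rewrite Xi add1n in cX.
have [||j] := IH (X :\ i); [by rewrite -cX | by rewrite -ltnS -cX ltn_neqAle nes |].
rewrite !inE => /andP[neji Xj] <-; exists j => //.
apply: eq_card => l; rewrite !inE; have [->/=|//] := eqVneq l i.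
rewrite Xi /=; apply/negbTE; rewrite -ltnNge ltn_neqAle; apply/andP; split=> //.
exact: maxi.
Qed.

Lemma threshold_inj N (X : {set 'I_N}) i i' : i \in X -> i' \in X ->
  #|[set j in X | j <= i]| = #|[set j in X | j <= i']| -> i = i'.
Proof.
wlog ltii' : i i' / i < i' => [IH Xi Xi' e|Xi Xi' e].
  by have [/IH->|/IH->|/val_inj] := ltngtP i i'.
suff : #|[set j in X | j <= i]| < #|[set j in X | j <= i']| by rewrite e ltnn.
apply: proper_card; apply/properP; split.
  by apply/subsetP=> j; rewrite !inE => /andP[-> /=]; lia.
by exists i'; rewrite !inE Xi' ?leqnn //= -ltnNge.
Qed.

Section IntervalFamilies.
Variable N : nat.
Local Notation family := {set 'I_N * 'I_N}.
Implicit Types (Q : family) (i j : 'I_N).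

(** A pair stands for the closed interval between its entries; [q'.1 = q.2] counts as a crossing,
    since such blocks overlap. The bound [n] is separate from [N] so that induction on [n] stays
    within one type. *)
Definition noncrossing n Q : bool :=
  [forall q in Q, q.1 < q.2 < n] &&
  [forall q in Q, forall q' in Q, ~~ ((q.1 < q'.1) && (q'.1 <= q.2 < q'.2))].

(* The left ends of the maximal blocks, points in no block counting as blocks. *)
Definition top_starts n Q : {set 'I_N} :=
  [set i : 'I_N | (i < n) && [forall q in Q, ~~ (q.1 < i <= q.2)]].

Definition families n k t : {set family} :=
  [set Q | [&& noncrossing n Q, #|Q| == k & #|top_starts n Q| == t]].

Lemma noncrossingP n Q : reflect
  ((forall q, q \in Q -> q.1 < q.2 < n) /\
   (forall q q', q \in Q -> q' \in Q -> ~ ((q.1 < q'.1) && (q'.1 <= q.2 < q'.2))))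
  (noncrossing n Q).
Proof.
apply: (iffP andP) => -[A B]; split.
- by move=> q Qq; apply: (implyP (forallP A q)).
- move=> q q' Qq Qq'; apply/negP.
  exact: (implyP (forallP (implyP (forallP B q) Qq) q')).
- by apply/forallP=> q; apply/implyP; apply: A.
- apply/forallP=> q; apply/implyP=> Qq; apply/forallP=> q'; apply/implyP=> Qq'.
  by apply/negP; apply: B.
Qed.

Lemma noncrossing_sub n Q Q' : Q' \subset Q -> noncrossing n Q -> noncrossing n Q'.
Proof.
move=> /subsetP sQ /noncrossingP[A B]; apply/noncrossingP.
by split=> [q /sQ/A|q q' /sQ Qq /sQ Qq']; [|apply: B].
Qed.

Lemma top_startsP n Q i : reflect
  (i < n /\ forall q, q \in Q -> ~ q.1 < i <= q.2) (i \in top_starts n Q).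
Proof.
rewrite inE; apply: (iffP andP) => -[A B]; split=> //.
- by move=> q Qq; apply/negP; apply: (implyP (forallP B q)).
- by apply/forallP=> q; apply/implyP=> Qq; apply/negP; apply: B.
Qed.

(** Take the smallest [j] among the last point and the left ends of intervals ending there. An
    interval covering both [j] and its predecessor would either give a smaller choice or cross the
    interval chosen. *)
Lemma last_top_start n Q : n < N -> noncrossing n.+1 Q ->
  exists2 j, j \in top_starts n.+1 Q &
    j = n :> nat \/ exists2 l, (j, l) \in Q & l = n :> nat.
Proof.
move=> ltnN /noncrossingP[A B].
pose P j := (j == n :> nat) || [exists l, ((j, l) \in Q) && (l == n :> nat)].
have P0 : P (Ordinal ltnN) by rewrite /P eqxx.
case: (arg_minnP (fun j : 'I_N => nat_of_ord j) P0) => j Pj minj.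
exists j.
  apply/top_startsP; split.
    case/orP: Pj => [/eqP->//|/existsP[l /andP[Ql _]]].
    by have /= := A _ Ql; lia.
  move=> [a b] Qab /= leab; have /= ltb := A _ Qab.
  have [eb|neb] := eqVneq (b : nat) n.
    have : P a by apply/orP; right; apply/existsP; exists b; rewrite Qab eb eqxx.
    by move/minj; lia.
  case/orP: Pj => [/eqP ej|/existsP[l /andP[Ql /eqP el]]]; first by lia.
  by apply: (B _ _ Qab Ql) => /=; lia.
case/orP: Pj => [/eqP|/existsP[l /andP[Ql /eqP el]]]; [by left | by right; exists l].
Qed.

Lemma card_families_k0 n t : n <= N -> #|families n 0 t| = (t == n).
Proof.
move=> lenN.
have card_top_starts : #|top_starts n set0| = n.
  have inj : injective (widen_ord lenN).
    by move=> i j /(congr1 val) e; apply: val_inj.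
  rewrite -[RHS](card_ord n) -(card_imset _ inj).
  apply: eq_card => i; apply/top_startsP/imsetP => [[lti _]|[j _ ->]].
    by exists (Ordinal lti) => //; apply: val_inj.
  by split=> [|q]; rewrite ?inE //=.
have -> : families n 0 t = if t == n then [set set0] else set0.
  apply/setP=> Q; rewrite inE cards_eq0.
  have [->|neQ] := eqVneq Q set0; last by rewrite andbF; case: ifP; rewrite !inE ?(negbTE neQ).
  rewrite card_top_starts [n == t]eq_sym; have -> : noncrossing n set0.
    by apply/noncrossingP; split=> q; rewrite inE.
  by case: ifP; rewrite !inE ?eqxx.
by case: ifP; rewrite ?cards1 ?cards0.
Qed.

Lemma card_families_n0 k t : #|families 0 k.+1 t| = 0.
Proof.
apply/eqP; rewrite cards_eq0; apply/eqP/setP=> Q; rewrite !inE.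
apply/negP=> /and3P[/noncrossingP[A _] /eqP cQ _].
have [q /A] : exists q, q \in Q by apply/set0Pn; rewrite -card_gt0 cQ.
by rewrite andbF.
Qed.

Lemma card_families_t0 n k : n < N -> #|families n.+1 k 0| = 0.
Proof.
move=> ltnN; apply/eqP; rewrite cards_eq0; apply/eqP/setP=> Q; rewrite !inE.
apply/negP=> /and3P[/(last_top_start ltnN)[j rj _] _]; rewrite cards_eq0 => /eqP r0.
by rewrite r0 inE in rj.
Qed.

Lemma top_starts_bound n Q : #|top_starts n Q| <= n.
Proof.
have sub : {subset top_starts n Q <= [pred i : 'I_N | i < n]}.
  by move=> i /top_startsP[].
have := uniq_leq_size (s1 := map val (enum (top_starts n Q))) (s2 := iota 0 n).
rewrite size_map size_iota -cardE; apply.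
  by rewrite map_inj_uniq ?enum_uniq //; apply: val_inj.
by move=> _ /mapP[i + ->]; rewrite mem_enum mem_iota => /top_startsP[].
Qed.

(** Double counting; the upper limit excludes no family, by [top_starts_bound]. *)
Lemma sum_card_families n k a :
  \sum_(a <= u < n.+1) #|families n k u| =
  #|[set Q | [&& noncrossing n Q, #|Q| == k & a <= #|top_starts n Q|]]|.
Proof.
under eq_bigr => u _ do rewrite -sum1_card big_mkcond.
rewrite exchange_big -sum1_card [RHS]big_mkcond; apply: eq_bigr => Q _ /=.
under eq_bigr => u _ do rewrite inE.
rewrite inE; case: (noncrossing n Q) => /=; last by rewrite big1.
case: (#|Q| == k) => /=; last by rewrite big1.
rewrite -big_mkcond sum1_count.
have -> : count (fun u => #|top_starts n Q| == u) (index_iota a n.+1) =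
    count_mem #|top_starts n Q| (index_iota a n.+1).
  by apply: eq_count => u /=; rewrite eq_sym.
rewrite count_uniq_mem ?iota_uniq // mem_index_iota.
by rewrite ltnS top_starts_bound andbT; case: (a <= _).
Qed.

(** The new interval merges the component starting at [i] with all later ones, so exactly the starts
    after [i] disappear. *)
Lemma top_starts_add_top n Q i (l : 'I_N) : l = n :> nat -> i \in top_starts n.+1 Q ->
  top_starts n.+1 ((i, l) |: Q) = [set j in top_starts n.+1 Q | j <= i].
Proof.
move=> el /top_startsP[ltin ri]; apply/setP=> j; rewrite [RHS]inE.
apply/top_startsP/andP => [[ltj rj]|[/top_startsP[ltj rj] leji]].
  split; first by apply/top_startsP; split=> // q Qq; apply: rj; rewrite !inE Qq orbT.
  by have /= := rj (i, l) (setU11 _ _); lia.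
by split=> // q; rewrite !inE => /predU1P[->/=|/rj //]; lia.
Qed.

Lemma families_rec n k t (ltnN : n < N) :
  #|families n.+1 k.+1 t.+1| =
  #|families n k.+1 t| + \sum_(t.+2 <= u < n.+2) #|families n.+1 k u|.
Proof.
pose l := Ordinal ltnN; rewrite sum_card_families.
set G := [set Q | _].
pose E := [set Q : family | [exists i, (i, l) \in Q]].
rewrite -[LHS](cardsID E) addnC; congr (_ + _).
  apply: eq_card => Q; rewrite in_setD !inE.
  (* An interval covering the last point must end there; without one, [l] is a component by
     itself. *)
  have top_starts_l : (forall i, (i, l) \notin Q) -> noncrossing n.+1 Q ->
      #|top_starts n.+1 Q| = #|top_starts n Q|.+1 /\ noncrossing n Q.
    move=> nE /noncrossingP[A B].
    have A' q : q \in Q -> q.1 < q.2 < n.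
      move=> Qq; have := A q Qq; suff : q.2 != n :> nat by lia.
      apply/eqP=> eq; have := nE q.1; have -> : l = q.2 by apply: val_inj.
      by rewrite -surjective_pairing Qq.
    split; last by apply/noncrossingP.
    have -> : top_starts n.+1 Q = l |: top_starts n Q.
      apply/setP=> j; rewrite in_setU1; apply/top_startsP/predU1P => [[ltj rj]|].
        have [->|nej] := eqVneq j l; [by left | right].
        by apply/top_startsP; split=> //; have : j != n :> nat by []; lia.
      case=> [->|/top_startsP[ltj rj]]; split=> //; last by lia.
      by move=> q /A' /=; lia.
    rewrite cardsU1; suff -> : l \notin top_starts n Q by [].
    by apply/negP=> /top_startsP[] /=; lia.
  apply/andP/idP => [[/existsPn nE /and3P[nc -> rt]]|/and3P[nc -> rt]].
    have [e ->] := top_starts_l nE nc; by rewrite e eqSS in rt.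
  have nE i : (i, l) \notin Q.
    apply/negP=> Qi; have /noncrossingP[A _] := nc.
    by have /= := A _ Qi; lia.
  have nc' : noncrossing n.+1 Q.
    have /noncrossingP[A B] := nc; apply/noncrossingP; split=> // q /A; lia.
  split; first by apply/existsPn.
  by have [-> _] := top_starts_l nE nc'; rewrite nc' eqSS rt.
(* cut Q i: the interval (i, l) can be added to Q so as to leave t.+1 components. *)
pose cut (Q : family) i := (i \in top_starts n.+1 Q) &&
  (#|[set j in top_starts n.+1 Q | j <= i]| == t.+1).
have cut_ex Q : Q \in G -> exists i, cut Q i.
  rewrite inE => /and3P[_ _ /ltnW/threshold_exists[i ri ei]].
  by exists i; rewrite /cut ri ei eqxx.
(* The default [l] is never reached on [G], by [cut_ex]. *)
pose add (Q : family) := (odflt l [pick i | cut Q i], l) |: Q.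
(* A family in [G] has at least [t.+2] components, so some start [j] lies beyond the cut. Hence the
   new interval has length at least 2 and was not there before. *)
have addE Q : Q \in G -> exists i,
    [/\ add Q = (i, l) |: Q, cut Q i & exists2 j, j \in top_starts n.+1 Q & i < j].
  move=> GQ; rewrite /add; case: pickP => [i ci|no]; last first.
    by have [i] := cut_ex Q GQ; rewrite no.
  exists i; split=> //; apply/exists_inP; apply: contraT => /exists_inPn no.
  move: ci GQ => /andP[_ /eqP ci]; rewrite inE -ci => /and3P[_ _].
  rewrite ltnNge => /negP[]; apply: subset_leq_card; apply/subsetP=> j rj.
  by rewrite inE rj leqNgt no.
have top_notin Q i : noncrossing n.+1 Q -> cut Q i ->
   (exists2 j, j \in top_starts n.+1 Q & i < j) -> (i, l) \notin Q.
  move=> nc ci [j /top_startsP[ltj rj] ltij]; apply/negP=> /rj /=; lia.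
have -> : families n.+1 k.+1 t.+1 :&: E = add @: G.
  apply/setP=> Q; apply/setIP/imsetP => [[]|[Q' GQ' ->]].
    rewrite !inE => /and3P[nc cQ rQ] /existsP[i0 Qi0].
    (* The interval to delete is the longest one ending at [l]. *)
    have [i Qi mini] : exists2 i, (i, l) \in Q & forall j, (j, l) \in Q -> i <= j.
      pose P i := (i, l) \in Q.
      by case: (@arg_minnP _ i0 P (fun i => nat_of_ord i) Qi0) => i; exists i.
    have ncQ' : noncrossing n.+1 (Q :\ (i, l)) by apply: noncrossing_sub nc; apply: subsetDl.
    have defQ := setD1K Qi; set Q' := Q :\ (i, l) in ncQ' defQ.
    have /noncrossingP[A B] := nc; have /= /andP[ltin _] := A _ Qi.
    (* An interval reaching over [i] from the left would end at [l], against the choice of [i], or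
       cross [(i, l)]. *)
    have ri : i \in top_starts n.+1 Q'.
      apply/top_startsP; split=> [|[a b]]; first exact: ltnW.
      rewrite !inE => /andP[_ Qab] /= leib.
      have /= := B _ _ Qab Qi; have /= := A _ Qab.
      have [ebl|] := eqVneq b l; last by rewrite -val_eqE /=; lia.
      by move: Qab; rewrite ebl => /mini; lia.
    have top_startsQ := top_starts_add_top (erefl : l = n :> nat) ri.
    rewrite defQ in top_startsQ.
    (* The last component of [Q'] starts after [i]: it is [l] alone, or it starts an interval ending
       at [l] that is shorter than the deleted one. *)
    have [j rj ltij] : exists2 j, j \in top_starts n.+1 Q' & i < j.
      have [j rj ej] := last_top_start ltnN ncQ'; exists j => //.
      case: ej => [->//|[l' + el]]; have -> : l' = l by apply: val_inj.
      rewrite !inE => /andP[+ /mini leij]; rewrite xpair_eqE eqxx andbT -val_eqE /=.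
      by lia.
    have GQ' : Q' \in G.
      rewrite inE ncQ'; have := cardsD1 (i, l) Q; rewrite Qi add1n (eqP cQ) => -[<-].
      rewrite eqxx -(eqP rQ) top_startsQ; apply: proper_card; apply/properP; split.
        by apply/subsetP=> x; rewrite inE => /andP[].
      by exists j; rewrite // inE rj -ltnNge.
    (* Both [i] and the cut chosen by [add] have [t.+1] starts up to them, so they coincide. *)
    exists Q' => //; have [i' [-> /andP[ri' /eqP ei'] _]] := addE _ GQ'.
    by rewrite -(threshold_inj ri ri') // ei' -top_startsQ; apply/eqP.
  have [i [-> ci exj]] := addE _ GQ'.
  have := GQ'; rewrite inE => /and3P[nc' cQ' rQ'].
  have nQ' := top_notin _ _ nc' ci exj.
  split; last by rewrite inE; apply/existsP; exists i; rewrite setU11.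
  have /andP[ri ei] := ci.
  rewrite inE cardsU1 nQ' add1n eqSS cQ' (top_starts_add_top _ ri) // ei !andbT.
  have /noncrossingP[A B] := nc'; have /top_startsP[lti ri'] := ri.
  case: exj => j /top_startsP[ltj _] ltij.
  apply/noncrossingP; split=> [q|q q']; rewrite !inE.
    by move=> /predU1P[->|/A] //=; lia.
  move=> /predU1P[->|Qq] /predU1P[->|Qq'] /=; first by lia.
  - by case: q' Qq' => a b /A /=; lia.
  - by case: q Qq => a b Qq; have /= := ri' _ Qq; have /= := A _ Qq; lia.
  - exact: B.
rewrite card_in_imset // => Q1 Q2 G1 G2.
have [i1 [-> c1 x1]] := addE _ G1; have [i2 [-> c2 x2]] := addE _ G2 => e.
(* The inserted interval is the longest one ending at [l], so the enlarged family determines it. *)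
have le_top Q Q' i i' : cut Q i -> (i, l) |: Q = (i', l) |: Q' -> i <= i'.
  move=> /andP[/top_startsP[lti ri] _] eQ; have := setU11 (i', l) Q'.
  rewrite -eQ !inE => /predU1P[[->]|/ri /=] //; by lia.
have ei : i1 = i2.
  apply: val_inj; apply/eqP; rewrite eqn_leq.
  by rewrite (le_top _ _ _ _ c1 e) (le_top _ _ _ _ c2 (esym e)).
subst i2; move: G1 G2; rewrite !inE => /and3P[nc1 _ _] /and3P[nc2 _ _].
by rewrite -(setU1K (top_notin _ _ nc1 c1 x1)) e setU1K // top_notin.
Qed.

Lemma card_families n k t : n <= N -> t <= n ->
  n * #|families n k t| = t * 'C((n + k).-1, k) * ncomp (n - t) k.
Proof.
apply: (@recurrence_solution N (fun n k t => #|families n k t|)) => {n k t}.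
- by move=> *; apply: card_families_k0.
- exact: card_families_n0.
- by move=> *; apply: card_families_t0.
- by move=> *; apply: families_rec.
Qed.

End IntervalFamilies.

(** * Nested sets of a list *)

Section Blocks.
Variables (T : finType) (n : nat) (a : n.-tuple T).
Hypothesis uniq_a : uniq a.
Implicit Types (q : 'I_n * 'I_n) (S : {set {set T}}).

Definition block q : {set T} := [set tnth a p | p in 'I_n & q.1 <= p <= q.2].

Lemma mem_block q p : (tnth a p \in block q) = (q.1 <= p <= q.2).
Proof.
apply/imsetP/idP => [[p' + /(tuple_uniqP a uniq_a) ->]|pq]; first by rewrite inE => /andP[].
by exists p; rewrite // inE.
Qed.

Lemma blockP q x : reflect (exists2 p, x = tnth a p & q.1 <= p <= q.2) (x \in block q).
Proof.
apply: (iffP imsetP) => [[p]|[p -> pq]]; first by rewrite inE => /andP[_ ? ->]; exists p.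
by exists p; rewrite // inE.
Qed.

(** Membership of the four end points determines the pair. Some restriction is needed because
    reversed pairs all give the empty block. *)
Lemma block_inj : {in [pred q : 'I_n * 'I_n | q.1 < q.2] &, injective block}.
Proof.
move=> [i j] [i' j'] /[!inE] /= ltij ltij' e.
have m (p : 'I_n) : (i <= p <= j) = (i' <= p <= j').
  by have := mem_block (i, j) p; rewrite e mem_block.
have := m i; have := m j; have := m i'; have := m j'; move=> m1 m2 m3 m4.
by congr (_, _); apply: val_inj => /=; lia.
Qed.

Lemma is_blockP B : reflect (exists q, B = block q) (is_block a B).
Proof.
apply: (iffP existsP) => [[i /existsP[j /eqP ->]]|[[i j] ->]]; first by exists (i, j).
by exists i; apply/existsP; exists j.
Qed.

Lemma card_block_gt1 q : (1 < #|block q|) = (q.1 < q.2).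
Proof.
apply/card_gt1P/idP => [[x [y [/blockP[p -> qp] /blockP[p' -> qp'] ne]]]|lt12].
  have : p != p' :> nat by apply: contraNneq ne => /val_inj ->.
  by case: q qp qp' => i j /=; lia.
exists (tnth a q.1), (tnth a q.2); rewrite !mem_block leqnn ltnW // leqnn.
by split=> //; apply: contraTneq lt12 => /(tuple_uniqP a uniq_a) ->; rewrite ltnn.
Qed.

(** The first point always starts a component. If it is the only start, [last_top_start] yields an
    interval from it to the last point, which differs from it as [1 < n]. *)
Lemma card_top_starts1 (Q : {set 'I_n * 'I_n}) (z l : 'I_n) :
    1 < n -> z = 0 :> nat -> l = n.-1 :> nat -> noncrossing n Q ->
  (#|top_starts n Q| == 1) = ((z, l) \in Q).
Proof.
move=> n_gt1 ez el nc; have rz : z \in top_starts n Q.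
  by apply/top_startsP; split=> // q _; rewrite ez.
apply/cards1P/idP => [[x rx]|Qzl].
  have n_eq : n.-1.+1 = n by lia.
  have [||j] := @last_top_start n n.-1 Q; [by lia | by rewrite n_eq |].
  rewrite n_eq; move: rz; rewrite rx !inE => /eqP <- /eqP -> [|[l' Ql' el']]; first by lia.
  by have -> : l = l' by apply: val_inj; rewrite /= el el'.
exists z; apply/setP=> j; rewrite in_set1; apply/idP/eqP => [/top_startsP[ltj rj]|-> //].
by apply: val_inj; have /= := rj _ Qzl; lia.
Qed.

Lemma block_full (z l : 'I_n) : z = 0 :> nat -> l = n.-1 :> nat ->
  block (z, l) = [set x in a].
Proof.
move=> ez el; apply/setP=> x; rewrite inE.
apply/blockP/tnthP => [[p -> _]|[p ->]]; exists p => //=.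
by have := ltn_ord p; lia.
Qed.

(** Noncrossing intervals correspond to blocks that are disjoint or nested, and having one component
    to containing the whole list. *)
Lemma nested_sets_imset k : 1 < n ->
  [set S | nested_set a S & #|S| == k] =
  (fun Q : {set _} => block @: Q) @: families n n k 1.
Proof.
move=> n_gt1.
have [z ez] : {z : 'I_n | z = 0 :> nat} by exists (Ordinal (ltnW n_gt1)).
have [l el] : {l : 'I_n | l = n.-1 :> nat}.
  by have lt : n.-1 < n; [lia | exists (Ordinal lt)].
have card_imset_block (Q : {set 'I_n * 'I_n}) :
    (forall q, q \in Q -> q.1 < q.2) -> #|block @: Q| = #|Q|.
  by move=> Qlt; apply: card_in_imset => q q' /Qlt ? /Qlt ?; apply: block_inj.
apply/setP=> S; rewrite inE; apply/andP/imsetP => [[/and3P[Sa Sb Sn] cS]|[Q]].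
  have {}Sb B : B \in S -> exists2 q : 'I_n * 'I_n, q.1 < q.2 & B = block q.
    move=> SB; have /andP[/is_blockP[q eB] gt1] := implyP (forallP Sb B) SB.
    by exists q; rewrite // -card_block_gt1 -eB.
  have {}Sn B C : B \in S -> C \in S ->
      [|| [disjoint B & C], B \subset C | C \subset B].
    by move=> SB; apply/implyP/(forallP (implyP (forallP Sn B) SB)).
  pose Q := [set q : 'I_n * 'I_n | (q.1 < q.2) && (block q \in S)].
  have QS q : q \in Q -> q.1 < q.2 by rewrite inE => /andP[].
  have defS : S = block @: Q.
    apply/setP=> B; apply/idP/imsetP => [SB|[q + ->]]; last by rewrite inE => /andP[].
    by have [q lt12 eB] := Sb B SB; exists q; rewrite // inE lt12 -eB.
  have nc : noncrossing n Q.
    apply/noncrossingP; split=> [q /QS ->|[i j] [i' j']]; first by rewrite ltn_ord.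
    rewrite !inE /= => /andP[_ Sq] /andP[_ Sq'] /and3P[lt1 le lt2].
    (* For crossing intervals, [i'] lies in both blocks, [i] only in the first and [j'] only in the
       second. *)
    have /or3P[] := Sn _ _ Sq Sq'.
    - move/disjoint_setI0/setP/(_ (tnth a i')); rewrite !inE !mem_block /=; lia.
    - move/subsetP/(_ (tnth a i)); rewrite !mem_block /=; lia.
    - move/subsetP/(_ (tnth a j')); rewrite !mem_block /=; lia.
  exists Q => //; rewrite inE nc -card_imset_block // -defS cS.
  rewrite (card_top_starts1 n_gt1 ez el nc).
  by rewrite inE (block_full ez el) Sa ez el; lia.
rewrite inE => /and3P[nc /eqP cQ r1] ->; have /noncrossingP[A B] := nc.
have Qlt q : q \in Q -> q.1 < q.2 by move/A/andP=> [].
split; last by rewrite card_imset_block // cQ.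
apply/and3P; split.
- rewrite -(block_full ez el); apply: imset_f.
  by rewrite -(card_top_starts1 n_gt1 ez el nc).
- apply/forallP=> C; apply/implyP=> /imsetP[q Qq ->].
  by rewrite card_block_gt1 Qlt // andbT; apply/is_blockP; exists q.
apply/forallP=> C; apply/implyP=> /imsetP[q Qq ->].
apply/forallP=> D; apply/implyP=> /imsetP[q' Qq' ->].
have := Qlt _ Qq; have := Qlt _ Qq'; have := B _ _ Qq Qq'; have := B _ _ Qq' Qq.
case: q q' {Qq Qq'} => [i j] [i' j'] /= n1 n2 lt' lt.
have [ltji'|leij'] := ltnP j i'.
  apply/or3P; apply: Or31; rewrite disjoint_subset; apply/subsetP=> _ /blockP[p -> /= ijp].
  by rewrite inE mem_block /=; lia.
have [ltji'|leij''] := ltnP j' i.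
  apply/or3P; apply: Or31; rewrite disjoint_subset; apply/subsetP=> _ /blockP[p -> /= ijp].
  by rewrite inE mem_block /=; lia.
apply/or3P; have [sub|nsub] := boolP ((i' <= i) && (j <= j')).
  apply: Or32; apply/subsetP=> _ /blockP[p -> /= ijp].
  by rewrite mem_block /=; lia.
apply: Or33; apply/subsetP=> _ /blockP[p -> /= ijp].
by rewrite mem_block /=; lia.
Qed.

(** The family is recovered as the set of increasing pairs whose block lies in the image. *)
Lemma imset_block_inj k :
  {in families n n k 1 &, injective (fun Q : {set _} => block @: Q)}.
Proof.
have defQ (Q : {set 'I_n * 'I_n}) : Q \in families n n k 1 ->
    Q = [set q : 'I_n * 'I_n | (q.1 < q.2) && (block q \in block @: Q)].
  rewrite inE => /and3P[/noncrossingP[A _] _ _]; apply/setP=> q; rewrite inE.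
  apply/idP/andP => [Qq|[lt12 /imsetP[q' Qq']]].
    by split; [have /andP[] := A q Qq | apply: imset_f].
  move/block_inj=> ->; rewrite ?inE //; by have /andP[] := A q' Qq'.
by move=> Q Q' /defQ defQ1 /defQ defQ2 /= e; rewrite defQ1 e -defQ2.
Qed.

Lemma card_S2 k : 1 < n -> #|S2 a k| = #|families n n k 1|.
Proof.
move=> n_gt1; rewrite -(card_in_imset (@imset_block_inj k)) -nested_sets_imset //.
rewrite -[RHS](card_imset _ (_ : injective (pair a))) => [|S S' []//].
apply: eq_card => -[b S]; rewrite inE; apply/and3P/imsetP => /= [[/eqP -> nS cS]|].
  by exists S; rewrite // inE nS.
by case=> S' + [-> ->]; rewrite inE => /andP[].
Qed.

End Blocks.

(** The entries of [a] are distinct, so different permutations give different lists and the union is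
    disjoint. *)
Lemma card_OS2 (T : finType) n (a : n.-tuple T) k : uniq a -> 1 < n ->
  #|OS2 a k| = n`! * #|families n n k 1|.
Proof.
move=> uniq_a n_gt1; pose b (s : 'S_n) := [tuple tnth a (s i) | i < n].
have b_inj : injective b.
  move=> s s' e; apply/permP=> i; apply: (tuple_uniqP a uniq_a).
  by have := congr1 (fun t => tnth t i) e; rewrite !tnth_mktuple.
have uniq_b s : uniq (b s).
  by apply/tuple_uniqP=> i j; rewrite !tnth_mktuple => /(tuple_uniqP a uniq_a)/perm_inj.
rewrite -sum1_card /OS2 partition_disjoint_bigcup => [|s s' ne].
  under eq_bigr => s _ do rewrite sum1_card (card_S2 (uniq_b s)) //.
  by rewrite big_const iter_addn_0 mulnC -card_Sn; congr (_ * _); apply: eq_card.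
rewrite -setI_eq0; apply/eqP/setP=> x; rewrite !inE; apply/negP.
by case/andP=> /andP[/eqP -> _] /andP[/eqP/b_inj e]; rewrite e eqxx in ne.
Qed.

(** * Total orders on a finite set *)

Section TotalOrders.
Variable T : finType.
Implicit Types (B : {set T}) (R : {set T * T}).

Lemma total_order_onP B R : reflect
  [/\ forall x y, (x, y) \in R -> (x \in B) && (y \in B),
      forall x, x \in B -> (x, x) \in R,
      forall x y, (x, y) \in R -> (y, x) \in R -> x = y,
      forall x y z, (x, y) \in R -> (y, z) \in R -> (x, z) \in R
    & forall x y, x \in B -> y \in B -> ((x, y) \in R) || ((y, x) \in R)]
  (total_order_on B R).
Proof.
apply: (iffP and5P) => -[sub refl anti trans tot]; split.
- by move=> x y /(subsetP sub); rewrite inE.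
- by move=> x; apply/implyP/(forallP refl).
- move=> x y xy yx; apply/eqP; have /implyP := forallP (forallP anti x) y.
  by apply; rewrite xy.
- move=> x y z xy yz; have /implyP := forallP (forallP (forallP trans x) y) z.
  by apply; rewrite xy.
- by move=> x y Bx; apply/implyP/(forallP (implyP (forallP tot x) Bx)).
- by apply/subsetP=> -[x y] /sub; rewrite inE.
- by apply/forallP=> x; apply/implyP/refl.
- apply/forallP=> x; apply/forallP=> y; apply/implyP=> /andP[xy yx].
  by rewrite (anti x y).
- apply/forallP=> x; apply/forallP=> y; apply/forallP=> z.
  by apply/implyP=> /andP[]; apply: trans.
- by apply/forallP=> x; apply/implyP=> Bx; apply/forallP=> y; apply/implyP/tot.
Qed.

Definition index_order (t : seq T) : {set T * T} :=
  [set xy | [&& xy.1 \in t, xy.2 \in t & index xy.1 t <= index xy.2 t]].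

Lemma index_order_total B (t : seq T) : t =i B -> total_order_on B (index_order t).
Proof.
move=> tB; apply/total_order_onP; split.
- by move=> x y; rewrite inE /= !tB => /and3P[-> ->].
- by move=> x Bx; rewrite inE /= !tB Bx leqnn.
- move=> x y; rewrite !inE /= => /and3P[tx ty le] /and3P[_ _ ge].
  by apply: (index_inj x tx ty); apply/eqP; rewrite eqn_leq le ge.
- move=> x y z; rewrite !inE /= => /and3P[-> _ le] /and3P[_ -> le'].
  exact: leq_trans le le'.
- by move=> x y Bx By; rewrite !inE /= !tB Bx By leq_total.
Qed.

Lemma sorted_index_order (t : seq T) : uniq t ->
  sorted (fun x y => (x, y) \in index_order t) t.
Proof.
move=> uniq_t; case def_t: t => [//|x0 t0]; rewrite -def_t {def_t}.
apply/(sortedP x0) => i lti.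
by have lti' := ltnW lti; rewrite inE /= !mem_nth ?index_uniq /=.
Qed.

(** Total orders on [B] correspond to duplicate-free enumerations of [B]: sorting by the order gives
    an enumeration, and a list sorted for a total order is unique. *)
Lemma card_total_orders B : #|[set R | total_order_on B R]| = #|B|`!.
Proof.
rewrite -ffactnn -card_uniq_tuples.
set U := [set t : #|B|.-tuple T | _ & _].
have memU (t : #|B|.-tuple T) : t \in U -> t =i B.
  rewrite inE => /andP[/allP sub uniq_t] x; rewrite -mem_enum.
  have [|||_ ->//] := @uniq_min_size _ t (enum B); rewrite -?cardE ?size_tuple //.
  by move=> y /sub; rewrite mem_enum.
have -> : [set R | total_order_on B R] = (fun t : #|B|.-tuple T => index_order t) @: U.
  apply/setP=> R; rewrite inE; apply/idP/imsetP => [RB|[t /memU tB ->]]; last first.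
    exact: index_order_total.
  have /total_order_onP[sub refl anti trans tot] := RB.
  pose le x y := (x, y) \in R; pose s := sort le (enum B).
  have ss : size s == #|B| by rewrite size_sort -cardE.
  have sB : s =i B by move=> x; rewrite mem_sort mem_enum.
  have su : uniq s by rewrite sort_uniq enum_uniq.
  have ssort : sorted le s.
    apply: (@sort_sorted_in _ (mem B)) => [x y|]; first exact: tot.
    by apply/allP=> x; rewrite mem_enum.
  have letr : transitive le by move=> y x z; apply: trans.
  exists (Tuple ss); first by rewrite inE su andbT; apply/allP=> x; rewrite sB.
  apply/setP=> -[x y]; rewrite inE /= !sB.
  apply/idP/and3P => [xy|[Bx By lexy]]; last first.
    apply: (@sorted_leq_index_in _ le s) => //; rewrite ?sB //.
      by move=> ? ? ? _ _ _; apply: letr.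
    by move=> z; rewrite sB; apply: refl.
  have /andP[Bx By] := sub _ _ xy; split=> //; rewrite leqNgt; apply/negP=> lt.
  have yx : le y x by apply: (sorted_ltn_index letr ssort) lt; rewrite sB.
  by rewrite (anti _ _ xy yx) ltnn in lt.
apply: card_in_imset => t t' tU t'U /= e; apply: val_inj => /=.
have tB := memU t tU; have t'B := memU t' t'U.
move: tU t'U; rewrite !inE => /andP[_ ut] /andP[_ ut'].
have /total_order_onP[sub refl anti trans tot] := index_order_total tB.
apply: (@sorted_eq_in _ (fun x y => (x, y) \in index_order t)).
- by move=> y x z _ _ _; apply: trans.
- by move=> x y _ _ /andP[]; apply: anti.
- exact: sorted_index_order.
- by rewrite e; apply: sorted_index_order.
by apply: uniq_perm => // x; rewrite tB t'B.
Qed.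

End TotalOrders.

(** * Internally ordered partitions *)

Lemma sum_subsets_card (T : finType) (Y : {set T}) (g : nat -> nat) :
  \sum_(C : {set T} | C \subset Y) g #|C| = \sum_(b < #|Y|.+1) 'C(#|Y|, b) * g b.
Proof.
rewrite (partition_big (fun C : {set T} => inord #|C| : 'I_(#|Y|.+1)) predT) //=.
apply: eq_bigr => b _; rewrite -['C(_, _)]cards_draws -[X in X * _]sum1_card big_distrl /=.
have card_b (C : {set T}) : C \subset Y -> (inord #|C| == b) = (#|C| == b).
  by move/subset_leq_card=> le; rewrite -val_eqE /= inordK.
apply: eq_big => C; last by move=> /andP[sCY]; rewrite card_b // mul1n => /eqP ->.
by rewrite inE; case sCY: (C \subset Y); rewrite //= card_b.
Qed.

(** This is the sum over part sizes [b.+1] in the recursion for partitions. With [v = m - b - k] it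
    becomes [sum_mul_ncomp] for [s = 1]. *)
Lemma sum_ncomp_shift m k :
  k.+1 * (\sum_(1 <= b < m.+1) b.+1 * ncomp (m - b - k) k) = m.+1 * ncomp (m - k) k.+1.
Proof.
have [lemk|ltkm] := leqP m k.
  have -> : m - k = 0 by lia.
  rewrite big_nat big1 ?muln0 // => b /andP[b1 bm].
  have -> : m - b - k = 0 by lia.
  by case: k lemk => [|k] ?; [lia | rewrite muln0].
have [D def_m] : {D | m = (D + k).+1} by exists (m - k).-1; lia.
have -> : m - k = D.+1 by lia.
rewrite (big_cat_nat (n := D.+2)) //=; last by lia.
(* Here the truncated subtraction gives [ncomp 0 k], which vanishes for [k > 0]; for [k = 0] the
   range is empty. *)
rewrite [X in _ + X]big_nat [X in _ + X]big1 ?addn0 => [|b /andP[b1 bm]]; last first.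
  have -> : m - b - k = 0 by lia.
  by case: k ltkm def_m => [|k] _ ?; [lia | rewrite muln0].
rewrite big_add1 big_nat_rev big_mkord /=.
rewrite (eq_bigr (fun v : 'I_D.+1 => (1 + (D.+1 - v)) * ncomp v k)); last first.
  by move=> [v ltv] _ /=; congr (_ * ncomp _ _); lia.
by rewrite sum_mul_ncomp; have /= := mul_bin_diag D.+1 k; nia.
Qed.

Section AdmissiblePartitions.
Variable T : finType.
Implicit Types (X B C : {set T}) (P : {set {set T}}).

Definition admissible_partitions X k : {set {set {set T}}} :=
  [set P | [&& partition P X, #|P| == k & [forall B in P, 2 <= #|B|]]].

Definition ordered_partition_count X k : nat :=
  \sum_(P in admissible_partitions X k) \prod_(B in P) #|B|`!.

(** On the right, [B \notin P] is automatic: [B] is nonempty and disjoint from [X :\: B]. *)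
Lemma admissible_partitionsU1 X B k P : B \subset X -> 1 < #|B| ->
  (B \notin P) && (B |: P \in admissible_partitions X k.+1) =
  (P \in admissible_partitions (X :\: B) k).
Proof.
move=> sBX gt1; have B0 : B != set0 by rewrite -card_gt0 ltnW.
rewrite !inE; apply/andP/and3P => [[nPB]|[pP cP aP]].
  rewrite cardsU1 nPB add1n eqSS => /and3P[pBP -> /forallP aBP]; split=> //.
    by have := partitionD1 pBP (setU11 B P); rewrite setU1K.
  by apply/forallP=> C; apply/implyP=> PC; apply: (implyP (aBP C)); rewrite !inE PC orbT.
have nPB : B \notin P.
  apply: contra B0 => /(partitionS pP) sB; rewrite -subset0.
  by apply/subsetP=> x Bx; have := subsetP sB x Bx; rewrite inE Bx.
split=> //; rewrite cardsU1 nPB add1n eqSS cP; apply/and3P; split=> //.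
  have <- : B :|: (X :\: B) = X by rewrite -[RHS](setID X B) (setIidPr sBX).
  by apply: partitionU1 => //; rewrite disjoints_subset setCD subsetUr.
apply/forallP=> C; apply/implyP; rewrite !inE => /predU1P[-> //|].
exact: (implyP (forallP aP C)).
Qed.

(** The part containing [x] is [x |: C]; admissibility makes [C] nonempty, and deleting this part
    leaves a partition of the rest. *)
Lemma ordered_partition_count_rec X x k : x \in X ->
  ordered_partition_count X k.+1 =
  \sum_(C : {set T} | (C \subset X :\ x) && (C != set0))
    #|C|.+1`! * ordered_partition_count (X :\: (x |: C)) k.
Proof.
move=> Xx; rewrite /ordered_partition_count.
have pblockP P : P \in admissible_partitions X k.+1 ->
    [/\ pblock P x \in P, x \in pblock P x, pblock P x \subset X & 1 < #|pblock P x|].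
  rewrite inE => /and3P[pP _ aP].
  have Px : pblock P x \in P by rewrite pblock_mem // (cover_partition pP).
  split; rewrite ?mem_pblock ?(cover_partition pP) //; first exact: partitionS Px.
  exact: (implyP (forallP aP _)).
rewrite (partition_big (fun P => pblock P x :\ x)
           (fun C : {set T} => (C \subset X :\ x) && (C != set0))) /=; last first.
  move=> P /pblockP[_ xB sBX gt1]; rewrite setSD //= -card_gt0.
  by have := cardsD1 x (pblock P x); rewrite xB; lia.
apply: eq_bigr => C /andP[sCX C0]; rewrite big_distrr /=.
have nCx : x \notin C by apply/negP=> /(subsetP sCX); rewrite !inE eqxx.
have sBX : x |: C \subset X.
  by rewrite subUset sub1set Xx (subset_trans sCX) ?subsetDl.
have gt1 : 1 < #|x |: C| by rewrite cardsU1 nCx add1n ltnS card_gt0.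
rewrite (reindex_onto (fun P => (x |: C) |: P) (fun P => P :\ (x |: C))) /=; last first.
  move=> P /andP[/pblockP[PB xB _ _] /eqP <-]; by rewrite setD1K // setD1K.
apply: eq_big => P.
  rewrite -(admissible_partitionsU1 k P sBX gt1).
  apply/andP/andP => [[/andP[aP _] /eqP eP]|[nPB aP]].
    by split=> //; rewrite -eP !inE eqxx.
  rewrite aP setU1K // eqxx; split=> //=.
  have := aP; rewrite inE => /and3P[/partition_trivIset tP _ _].
  by rewrite (def_pblock tP (setU11 _ _)) ?setU11 // setU1K.
move=> /andP[_ /eqP eP]; have nPB : x |: C \notin P by rewrite -eP !inE eqxx.
by rewrite big_setU1 //= cardsU1 nCx.
Qed.

Lemma ordered_partition_count_fact X k :
  k`! * ordered_partition_count X k = #|X|`! * ncomp (#|X| - k) k.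
Proof.
elim: k X => [|k IHk] X.
  rewrite mul1n subn0 /ordered_partition_count; have [->|X0] := eqVneq X set0.
    rewrite cards0 (big_pred1 set0) ?big_set0 // => P.
    rewrite inE partition_set0 /=; case: eqVneq => //= ->.
    by rewrite cards0 eqxx; apply/forallP=> B; rewrite inE.
  rewrite big1 => [|P]; last first.
    rewrite inE cards_eq0 => /and3P[/cover_partition + /eqP P0 _].
    by rewrite P0 /cover big_set0 => e; rewrite -e eqxx in X0.
  by move: X0; rewrite -card_gt0; case: #|X| => // d _; rewrite muln0.
have [->|[x Xx]] := set_0Vmem X.
  rewrite cards0 sub0n muln0 /ordered_partition_count big1 ?muln0 // => P.
  by rewrite inE partition_set0 => /and3P[/eqP->]; rewrite cards0.
rewrite (ordered_partition_count_rec _ Xx) (cardsD1 x X) Xx add1n subSS.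
set Y := X :\ x; set m := #|Y|.
(* The value 0 at [c = 0] encodes the ban on the singleton part, so the sum can run over all subsets
   and be grouped by size. *)
pose g c := if c == 0 then 0 else k.+1 * (c.+1`! * ((m - c)`! * ncomp (m - c - k) k)).
transitivity (\sum_(C : {set T} | C \subset Y) g #|C|).
  rewrite big_distrr /= [RHS](bigID (fun C : {set T} => C != set0)) /= [X in _ + X]big1 ?addn0.
    apply: eq_bigr => C /andP[sCY C0]; rewrite /g cards_eq0 (negbTE C0).
    have nCx : x \notin C by apply/negP=> /(subsetP sCY); rewrite !inE eqxx.
    have -> : m - #|C| = #|X :\: (x |: C)|.
      by rewrite -setDDl cardsD (setIidPr sCY).
    by rewrite -IHk factS; set a := _`!; lia.
  by move=> C /andP[_]; rewrite negbK => /eqP ->; rewrite /g cards0.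
rewrite sum_subsets_card big_ord_recl {1}/g muln0 add0n.
have -> : m.+1`! * ncomp (m - k) k.+1 = m`! * (m.+1 * ncomp (m - k) k.+1).
  by rewrite factS; lia.
rewrite -sum_ncomp_shift big_add1 big_mkord /= !big_distrr /=.
apply: eq_bigr => -[b ltb] _; rewrite /bump /= add1n /g /=.
rewrite -(bin_fact (ltb : b.+1 <= m)) (factS b.+1).
by set u := 'C(m, _); set v := b.+1`!; set w := (m - b.+1)`!; set z := ncomp _ _; nia.
Qed.

End AdmissiblePartitions.

(** For a fixed partition the order function is [set0] off the parts, so its choices form a product
    over the parts. *)
Lemma card_IT2 m k : #|IT2 m k| = ordered_partition_count [set: 'I_m] k.
Proof.
pose F B := [pred R | @total_order_on 'I_m B R].
transitivity (\sum_(P in admissible_partitions [set: 'I_m] k) #|pfamily set0 P F|).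
  under [RHS]eq_bigr => P _ do rewrite -sum1_card.
  rewrite pair_big_dep -sum1_card; apply: eq_bigl => P; rewrite inE [in RHS]inE.
  rewrite /internally_ordered_partition /admissible -!andbA.
  by do 4!congr (_ && _); rewrite andbC.
apply: eq_bigr => P _; rewrite card_pfamily foldrE big_map big_enum /=.
apply: eq_bigr => B _; rewrite -card_total_orders.
by apply: eq_card => R; rewrite !inE.
Qed.

(** * From equal cardinalities to a bijection *)

Lemma card_eq_bijection (T U : finType) (A : {set T}) (B : {set U}) :
  #|A| = #|B| -> exists f : {x | x \in A} -> {y | y \in B}, bijective f.
Proof.
move=> eAB; have e : #|{: {x | x \in A}}| = #|{: {y | y \in B}}| by rewrite !card_sig.
exists (fun x => enum_val (cast_ord e (enum_rank x))).
exists (fun y => enum_val (cast_ord (esym e) (enum_rank y))) => x.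
  by rewrite enum_valK cast_ordK enum_rankK.
by rewrite enum_valK cast_ordKV enum_rankK.
Qed.

Unset Implicit Arguments.

Theorem theorem2p2 (n k : nat) (hn : 2 <= n) (hk : 1 <= k <= n - 1) :
  exists f : {x | x \in OS2 (ord_tuple n) k} -> {P | P \in IT2 (n + k - 1) k},
    bijective f.
Proof.
apply: card_eq_bijection; rewrite card_IT2 card_OS2 ?val_ord_tuple ?enum_uniq //.
apply/eqP; rewrite -(eqn_pmul2l (fact_gt0 k)) ordered_partition_count_fact; apply/eqP.
rewrite cardsT card_ord; have n_gt0 := ltnW hn.
have := card_families k (leqnn n) n_gt0.
rewrite mul1n -subn1; have -> : n + k - 1 - k = n - 1 by lia.
have lek : k <= n + k - 1 by lia.
rewrite -(bin_fact lek); have -> : n + k - 1 - k = n.-1 by lia.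
case: n n_gt0 {hn hk lek} => // n _; rewrite factS /= => e.
by rewrite [n.+1 * _]mulnC -mulnA e; lia.
Qed.
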